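(* Let $(W,S)$ be a Coxeter system with $S$ finite. The set $L \subseteq S^*$ of all reduced expressions of cyclically fully commutative elements of $W$ is a regular language over the alphabet $S$ (i.e., it is recognized by a finite deterministic automaton).
   Context: A Coxeter system $(W,S)$ consists of a group $W$ generated by a finite set $S$ of involutions subject to the relations $(st)^{m_{st}}=1$ for $s \neq t$ with $m_{st} \in \{2,3,\ldots\}\cup\{\infty\}$ (no relation if $m_{st}=\infty$). Words in the free monoid $S^*$ are called expressions. The Coxeter length $\ell(w)$ is the minimal length of an expression representing $w$; expressions of that length are reduced expressions, and $R(w)$ denotes the set of reduced expressions of $w$. For $m_{st}=2$ the relation $st=ts$ is a commutation relation. An element $w$ is fully commutative (FC) if any two words of $R(w)$ can be linked by a sequence of commutation relations (swapping adjacent letters $s,t$ with $m_{st}=2$). A cyclic shift of a word $s_1\cdots s_n$ is any word $s_k s_{k+1}\cdots s_n s_1 \cdots s_{k-1}$ for $k\in\{1,\ldots,n\}$. An element $w \in W$ is cyclically fully commutative (CFC) if every cyclic shift of every word in $R(w)$ is a reduced expression of some fully commutative element (possibly different from $w$). *)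

(* Defs.v *)
From mathcomp Require Import all_boot.
Set Implicit Arguments. Unset Strict Implicit. Unset Printing Implicit Defensive.

(* A Coxeter matrix on a finite set S of generators, with the convention
   that m s t = 0 encodes m_{st} = infinity. *)
Definition coxeter_matrix (S : finType) (m : S -> S -> nat) : Prop :=
  [/\ forall s, m s s = 1,
      forall s t, m s t = m t s &
      forall s t, s != t -> m s t != 1].

Fixpoint alt (S : Type) (s t : S) (k : nat) : seq S :=
  if k is k'.+1 then s :: alt t s k' else [::].

(* Equality in W of two expressions: the congruence on S^* generated by the
   defining relations (st)^{m_st} = 1 (for m_st finite; for s = t this is
   s^2 = 1). Since the generators are involutions, S^* / coxeq is exactly
   the group W presented by (S, m). *)
Inductive coxeq (S : finType) (m : S -> S -> nat) : seq S -> seq S -> Prop :=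
| coxeq_refl u : coxeq m u u
| coxeq_sym u v : coxeq m u v -> coxeq m v u
| coxeq_trans u v w : coxeq m u v -> coxeq m v w -> coxeq m u w
| coxeq_rel a b s t : 0 < m s t ->
    coxeq m (a ++ alt s t (2 * m s t) ++ b) (a ++ b).

Inductive commeq (S : finType) (m : S -> S -> nat) : seq S -> seq S -> Prop :=
| commeq_refl u : commeq m u u
| commeq_sym u v : commeq m u v -> commeq m v u
| commeq_trans u v w : commeq m u v -> commeq m v w -> commeq m u w
| commeq_step a b s t : m s t = 2 ->
    commeq m (a ++ [:: s; t] ++ b) (a ++ [:: t; s] ++ b).

Definition reduced (S : finType) (m : S -> S -> nat) (u : seq S) : Prop :=
  forall v, coxeq m u v -> size u <= size v.

Definition fc_elt (S : finType) (m : S -> S -> nat) (u : seq S) : Prop :=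
  forall v1 v2, reduced m v1 -> reduced m v2 ->
    coxeq m u v1 -> coxeq m u v2 -> commeq m v1 v2.

Definition cfc_elt (S : finType) (m : S -> S -> nat) (u : seq S) : Prop :=
  forall v, reduced m v -> coxeq m u v ->
    forall k, reduced m (rot k v) /\ fc_elt m (rot k v).

Definition cfc_language (S : finType) (m : S -> S -> nat) (u : seq S) : Prop :=
  reduced m u /\ cfc_elt m u.

Definition regular_language (S : finType) (L : seq S -> Prop) : Prop :=
  exists (Q : finType) (q0 : Q) (delta : Q -> S -> Q) (F : pred Q),
    forall u, L u <-> F (foldl delta q0 u).

(* Main.v *)
(* A word is a reduced expression of an FC element iff no word in its commutation
   class has a factor s s or a braid word of length m_st >= 3 (Stembridge); this
   rests on the exchange property, which comes from the invariance of the parity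
   of reflection multiplicities, and on st having order exactly m_st, which is
   seen on a reflection representation over the algebraic numbers. So u fails to
   be CFC iff some conjugate y x of u = x y (in the trace monoid of commutation
   classes) is the class of a word with such a factor. The product, in the trace
   monoid, of two commutation-closed regular languages is regular, and both the
   words with a bad factor and their conjugates are finite unions of such
   products. *)
Require Import Defs.
From mathcomp Require Import all_boot.
From mathcomp Require Import all_algebra all_field.
From mathcomp Require Import boolp.
From mathcomp Require Import zify ring.

Set Implicit Arguments. Unset Strict Implicit. Unset Printing Implicit Defensive.
Import GRing.Theory Num.Theory.

(** * Alternating words *)

Section Alt.
Variable S : eqType.
Implicit Types (s t : S) (k l : nat).

Lemma size_alt s t k : size (alt s t k) = k.
Proof. by elim: k s t => //= k IH s t; rewrite IH. Qed.

Lemma alt_rcons s t k :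
  alt s t k.+1 = rcons (alt s t k) (if odd k then t else s).
Proof.
elim: k s t => // k IH s t.
by rewrite -[LHS]/(s :: alt t s k.+1) IH /= if_neg.
Qed.

Lemma rev_alt s t k : rev (alt s t k) = if odd k then alt s t k else alt t s k.
Proof.
elim: k s t => // k IH s t; rewrite [alt s t _]/= rev_cons IH !alt_rcons /=.
by have /= := alt_rcons s t k; case: (odd k).
Qed.

Lemma alt_catD s t k l :
  alt s t (k + l) = alt s t k ++ (if odd k then alt t s l else alt s t l).
Proof. by elim: k s t => //= k IH s t; rewrite IH; case: (odd k). Qed.

Lemma alt_cat_rev s t k : alt s t (2 * k) = alt s t k ++ rev (alt t s k).
Proof. by rewrite mul2n -addnn alt_catD rev_alt. Qed.

Lemma alt_even_catD s t k l :
  alt s t (2 * k + l) = alt s t (2 * k) ++ alt s t l.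
Proof. by rewrite alt_catD mul2n odd_double. Qed.

Lemma alt_palindrome s t k :
  s :: rcons (alt t s (2 * k).+1) s = alt s t (2 * k.+1).+1.
Proof.
rewrite [2 * k.+1]mulnS -[RHS]/(s :: t :: alt s t (2 * k).+1) [alt s t _]alt_rcons.
by rewrite mul2n odd_double.
Qed.

Lemma alt_prefix s t k x a c b :
  alt s t k ++ x = a ++ c :: b -> size a < k ->
  a = alt s t (size a) /\ rcons a c = alt s t (size a).+1.
Proof.
move=> e lt; have take_alt l : l <= k -> take l (alt s t k) = alt s t l.
  by move=> le; rewrite -(subnKC le) alt_catD take_size_cat ?size_alt.
have take_pre l : l <= k -> take l (a ++ c :: b) = alt s t l.
  by move=> le; rewrite -e takel_cat ?size_alt // take_alt.
split; first by rewrite -(take_pre _ (ltnW lt)) take_size_cat.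
by rewrite -(take_pre _ lt) -cat_rcons take_size_cat ?size_rcons.
Qed.

End Alt.

(** * Words modulo the Coxeter relations, reflection parities and the exchange property *)

Section CoxeterWords.
Variables (S : finType) (m : S -> S -> nat).
Hypothesis cm : coxeter_matrix m.

Local Notation coxeq := (coxeq m).
Local Notation reduced := (reduced m).
Implicit Types (s t r : S) (a b u v w x y : seq S).

Lemma coxeq_ctx a b u v : coxeq u v -> coxeq (a ++ u ++ b) (a ++ v ++ b).
Proof.
elim=> {u v} [u|u v _ IH|u v w _ IH1 _ IH2|c d s t mst].
- exact: coxeq_refl.
- exact: coxeq_sym.
- exact: coxeq_trans IH1 IH2.
- by have := coxeq_rel (a ++ c) (d ++ b) mst; rewrite !catA.
Qed.

Lemma coxeq_catl a u v : coxeq u v -> coxeq (a ++ u) (a ++ v).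
Proof. by move/(coxeq_ctx a [::]); rewrite !cats0. Qed.

Lemma coxeq_catr b u v : coxeq u v -> coxeq (u ++ b) (v ++ b).
Proof. exact: (coxeq_ctx [::] b). Qed.

Lemma coxeq_cons s u v : coxeq u v -> coxeq (s :: u) (s :: v).
Proof. exact: (coxeq_catl [:: s]). Qed.

Lemma coxeq_ss a s b : coxeq (a ++ s :: s :: b) (a ++ b).
Proof.
have [mss _ _] := cm.
by have := @coxeq_rel S m a b s s; rewrite mss; apply.
Qed.

Lemma coxeq_mulKV a b u : coxeq (a ++ u ++ rev u ++ b) (a ++ b).
Proof.
elim: u a b => [|s u IH] a b; first exact: coxeq_refl.
rewrite rev_cons cat_rcons -[s :: u]cat1s -catA catA.
apply: coxeq_trans (IH _ _) _; rewrite -catA; exact: coxeq_ss.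
Qed.

Lemma coxeq_mulVK a b u : coxeq (a ++ rev u ++ u ++ b) (a ++ b).
Proof. by have := coxeq_mulKV a b (rev u); rewrite revK. Qed.

Lemma coxeq_cancel_l a u v : coxeq (a ++ u) (a ++ v) -> coxeq u v.
Proof.
move=> /(coxeq_catl (rev a)) e.
apply: coxeq_trans (coxeq_sym (coxeq_mulVK [::] u a)) _.
exact: coxeq_trans e (coxeq_mulVK [::] v a).
Qed.

Lemma coxeq_cancel_r b u v : coxeq (u ++ b) (v ++ b) -> coxeq u v.
Proof.
move=> /(coxeq_catr (rev b)); rewrite -!catA => e.
have K w := coxeq_mulKV w [::] b.
move: (K u) (K v); rewrite !cats0 => Ku Kv.
exact: coxeq_trans (coxeq_sym Ku) (coxeq_trans e Kv).
Qed.

Lemma coxeq_consK s u v : coxeq (s :: u) (s :: v) -> coxeq u v.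
Proof. exact: (@coxeq_cancel_l [:: s]). Qed.

Lemma coxeq_braid s t : 0 < m s t -> coxeq (alt s t (m s t)) (alt t s (m s t)).
Proof.
move=> mst; apply: (@coxeq_cancel_r (rev (alt t s (m s t)))).
rewrite -alt_cat_rev.
have K := coxeq_mulKV [::] [::] (alt t s (m s t)); rewrite cats0 in K.
apply: coxeq_trans (coxeq_sym K).
by have := coxeq_rel [::] [::] mst; rewrite /= cats0.
Qed.

(** Every relator has even length: this is the sign character of the group. *)
Lemma coxeq_odd_size u v : coxeq u v -> odd (size u) = odd (size v).
Proof.
elim=> {u v} // [u v w _ -> _ -> //|a b s t _].
by rewrite !size_cat !oddD size_alt mul2n odd_double.
Qed.

Lemma reduced_coxeq u v : reduced u -> coxeq u v -> size u = size v -> reduced v.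
Proof. by move=> ru uv e w vw; rewrite -e; apply: ru; apply: coxeq_trans vw. Qed.

Lemma nreduced u : ~ reduced u -> exists2 v, coxeq u v & size v < size u.
Proof.
move=> nr; apply: contrapT => ne; apply: nr => v uv.
by rewrite leqNgt; apply/negP => lt; apply: ne; exists v.
Qed.

Lemma reduced_suffix a u : reduced (a ++ u) -> reduced u.
Proof.
move=> r v uv; have := r _ (coxeq_catl a uv).
by rewrite !size_cat leq_add2l.
Qed.

(* [nrefl u x] is the parity of the number of decompositions u = a s b with
   a s a^-1 = x in the group. *)
Fixpoint nrefl u x : bool :=
  if u is s :: u' then `[< coxeq [:: s] x >] (+) nrefl u' (s :: rcons x s)
  else false.

Lemma asbool_coxeq u v x y :
  coxeq u v -> coxeq x y -> `[< coxeq u x >] = `[< coxeq v y >].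
Proof.
move=> uv xy; apply/asboolP/asboolP => h.
  exact: coxeq_trans (coxeq_sym uv) (coxeq_trans h xy).
exact: coxeq_trans uv (coxeq_trans h (coxeq_sym xy)).
Qed.

Lemma nrefl_coxeqr u x y : coxeq x y -> nrefl u x = nrefl u y.
Proof.
elim: u x y => //= s u IH x y xy; congr (_ (+) _).
  by apply: asbool_coxeq => //; apply: coxeq_refl.
by apply: IH; rewrite -!cats1; apply: (coxeq_ctx [:: s]).
Qed.

(** Cocycle rule: a reflection contributed by a letter of [b] appears in [a ++ b] conjugated by
    [a]. *)
Lemma nrefl_cat a b x : nrefl (a ++ b) x = nrefl a x (+) nrefl b (rev a ++ x ++ a).
Proof.
elim: a x => [|s a IH] x /=; first by rewrite cats0.
by rewrite IH addbA rev_cons cat_rcons /= cat_rcons.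
Qed.

Lemma coxeq_conj s u x : coxeq u (s :: rcons x s) <-> coxeq (s :: rcons u s) x.
Proof.
have K y : coxeq (s :: rcons (s :: rcons y s) s) y.
  rewrite -!cats1 /= -catA /=; apply: coxeq_trans (coxeq_ss [::] s _) _.
  by rewrite -[X in coxeq _ X]cats0; apply: coxeq_ss.
have C y z : coxeq y z -> coxeq (s :: rcons y s) (s :: rcons z s).
  by rewrite -!cats1; apply: (coxeq_ctx [:: s]).
split=> h; first exact: coxeq_trans (C _ _ h) (K x).
by apply: coxeq_trans (C _ _ h); apply: coxeq_sym.
Qed.

(** The letter at position [i] contributes its conjugate by the first [i] letters, which is the
    alternating word of length [2 * i + 1]. *)
Lemma nrefl_alt s t k x :
  nrefl (alt s t k) x =
  odd (count (fun i => `[< coxeq (alt s t (2 * i).+1) x >]) (iota 0 k)).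
Proof.
elim: k s t x => // k IH s t x.
rewrite [iota 0 _]/= [count _ _]/= oddD oddb [alt s t _]/= [nrefl _ _]/= IH.
congr (_ (+) odd _); rewrite (iotaDl 1 0) count_map; apply: eq_count => i.
rewrite -[RHS]/(`[< coxeq (alt s t (2 * i.+1).+1) x >]) -alt_palindrome.
by apply/asboolP/asboolP => /coxeq_conj.
Qed.

(** Positions [i] and [m s t + i] contribute the same reflection, so every reflection is counted an
    even number of times. *)
Lemma nrefl_rel s t x : 0 < m s t -> nrefl (alt s t (2 * m s t)) x = false.
Proof.
move=> mst; rewrite nrefl_alt mul2n -addnn iotaD count_cat oddD add0n.
rewrite -{2}[m s t]addn0 iotaDl count_map.
rewrite [in X in _ (+) X](@eq_count _ _ (fun i => `[< coxeq (alt s t (2 * i).+1) x >])).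
  by rewrite addbb.
move=> i; rewrite -[LHS]/(`[< coxeq (alt s t (2 * (m s t + i)).+1) x >]).
apply: asbool_coxeq; last exact: coxeq_refl.
rewrite mulnDr -[(_ + _).+1]addnS alt_even_catD.
exact: (coxeq_rel [::]).
Qed.

(** By the cocycle rule, inserting a relator adds an even count and conjugates the later reflections
    by a trivial element. *)
Lemma nrefl_coxeql u v : coxeq u v -> nrefl u =1 nrefl v.
Proof.
elim=> {u v} [//|u v _ IH x //|u v w _ IH1 _ IH2 x|a b s t mst x].
- by rewrite IH1.
rewrite !nrefl_cat nrefl_rel // /=; congr (_ (+) _); apply: nrefl_coxeqr.
set y := _ ++ _ ++ a; set c := alt _ _ _.
have c1 : coxeq c [::] by have := coxeq_rel [::] [::] mst; rewrite cats0.
apply: coxeq_trans (coxeq_catl _ (coxeq_catl _ c1)) _; rewrite cats0.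
rewrite -[X in coxeq _ X]/([::] ++ y); apply: coxeq_catr.
apply: (@coxeq_cancel_r c); apply: coxeq_trans (coxeq_sym c1).
by have := coxeq_mulVK [::] [::] c; rewrite cats0.
Qed.

Lemma nreflP u x :
  nrefl u x -> exists a s b, u = a ++ s :: b /\ coxeq (rcons a s) (x ++ a).
Proof.
elim: u x => //= s u IH x; case: asboolP => [sx _|_ /= /IH].
  by exists [::], s, u; rewrite cats0.
case=> a [t [b [-> e]]]; exists (s :: a), t, b; split=> //=.
apply: coxeq_trans (coxeq_cons s e) _; rewrite cat_cons cat_rcons.
exact: coxeq_ss [::] _ _.
Qed.

(** The first letter contributes [s]. If a letter of [v] contributed it too, both could be deleted,
    contradicting reducedness. *)
Lemma nrefl_reduced s v : reduced (s :: v) -> nrefl (s :: v) [:: s].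
Proof.
move=> r /=; rewrite asboolT; last exact: coxeq_refl.
rewrite (nrefl_coxeqr v (coxeq_ss [::] s [:: s])) addTb.
apply/negP => /nreflP [a [t [b [e h]]]].
have /r : coxeq (s :: v) (a ++ b).
  rewrite e -cat_rcons; apply: (@coxeq_consK s).
  apply: coxeq_trans (coxeq_ss [::] s _) _; exact: (coxeq_catr b h).
by rewrite /= e !size_cat /=; lia.
Qed.

(** The parity of the reflection [s] is odd for [s :: v], hence for [u], so some letter [c] of [u]
    contributes it. That letter can then be traded for an [s] in front. *)
Lemma exchange s u v :
  reduced (s :: v) -> coxeq u (s :: v) ->
  exists a c b, u = a ++ c :: b /\ coxeq (rcons a c) (s :: a).
Proof.
move=> r /nrefl_coxeql /(_ [:: s]); rewrite nrefl_reduced // => /nreflP.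
by case=> a [c [b [-> h]]]; exists a, c, b.
Qed.

Lemma reduced_or_descent s u :
  reduced u -> ~ reduced (s :: u) -> exists2 v, reduced (s :: v) & coxeq u (s :: v).
Proof.
move=> ru /nreduced [v suv lt].
have e : coxeq u (s :: v).
  apply: coxeq_trans (coxeq_cons s suv); apply: coxeq_sym; exact: coxeq_ss [::] _ _.
exists v => //; apply: (reduced_coxeq ru e).
(* The bounds leave two possible lengths for [v]; parity excludes that of [u]. *)
move: (ru _ e) (coxeq_odd_size e) lt => /=; lia.
Qed.

End CoxeterWords.

(** * A reflection representation over the algebraic numbers, bounding the order of [st] from
    below *)

Section Reflection.
Variables (S : finType) (m : S -> S -> nat).
Hypothesis cm : coxeter_matrix m.
Local Notation coxeq := (coxeq m).
Implicit Types (s t r : S) (u v : seq S).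
Local Open Scope ring_scope.

Lemma root_of_order (n : nat) :
  n != 1%N -> exists z : algC, z != 0 /\ forall i, (z ^+ (2 * i) == 1) = (n %| i)%N.
Proof.
case: n => [_|n n1].
  exists 2; split=> [|i]; first by rewrite pnatr_eq0.
  by rewrite dvd0n -natrX pnatr_eq1 -[X in _ == X](expn0 2) eqn_exp2l // muln_eq0.
have [z zP] := @C_prim_root_exists (2 * n.+1) isT; exists z; split=> [|i].
  apply/eqP => z0; have /eqP := prim_expr_order zP.
  by rewrite z0 expr0n eq_sym oner_eq0.
by rewrite -(prim_order_dvd zP) dvdn_pmul2l.
Qed.

Variable q : nat -> algC.
Hypothesis qP : forall n, n != 1%N ->
  q n != 0 /\ forall i, (q n ^+ (2 * i) == 1) = (n %| i)%N.

(* The Cartan matrix of the geometric representation, with 2 cos (pi / m)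
   generalized to q + q^-1 where q is a primitive 2m-th root of unity (any q of
   infinite order if m is infinite). *)
Definition cartan s t : algC :=
  if s == t then 2 else - (q (m s t) + (q (m s t))^-1).

(** A function [f] stands for a linear form given by its values on the simple roots; it is composed
    with the reflection in the root of [s]. *)
Definition reflect_fun s (f : S -> algC) : S -> algC :=
  fun r => f r - f s * cartan s r.

Definition act u (f : S -> algC) : S -> algC :=
  foldl (fun g s => reflect_fun s g) f u.

Lemma act_cat u v f : act (u ++ v) f = act v (act u f).
Proof. exact: foldl_cat. Qed.

(** On the pair of values at [s] and [t], the word [st] has eigenvectors [(1, - z^-1)] and
    [(1, - z)] with eigenvalues [z ^+ 2] and [z^-1 ^+ 2]; [A] and [B] are the components along them.
    The geometric sums add up what the successive reflections subtract. *)
Lemma act_alt k s t f A B (z := q (m s t)) : s != t ->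
    f s = A + B -> f t = - (A * z^-1 + B * z) ->
  let g := act (alt s t (2 * k)) f in
  g s = A * z ^+ (2 * k) + B * z^-1 ^+ (2 * k) /\
  forall r, g r = f r
    - (A * (\sum_(i < k) z ^+ (2 * i)) + B * (\sum_(i < k) z^-1 ^+ (2 * i)))
        * cartan s r
    - (A * z * (\sum_(i < k) z ^+ (2 * i)) + B * z^-1 * (\sum_(i < k) z^-1 ^+ (2 * i)))
        * cartan t r.
Proof.
move=> st; have [_ msym mst1] := cm.
have [z0 _] := qP (mst1 _ _ st); rewrite -/z in z0.
have zV : z * z^-1 = 1 by rewrite mulfV.
have cst : cartan s t = - (z + z^-1) by rewrite /cartan (negPf st).
have cts : cartan t s = - (z + z^-1) by rewrite /cartan eq_sym (negPf st) msym.
have css r : cartan r r = 2 by rewrite /cartan eqxx.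
elim: k f A B => [|k IH] f A B fs ft g.
  rewrite /g !big_ord0 !muln0 !expr0 !mulr1 /=; split=> // r.
  by rewrite !mulr0 !addr0 !mul0r !subr0.
pose f' := reflect_fun t (reflect_fun s f).
have f't r : f' r = f r - (A + B) * cartan s r - (A * z + B * z^-1) * cartan t r.
  by rewrite /f' /reflect_fun fs ft cst; ring.
have -> : g = act (alt s t (2 * k)) f' by rewrite /g mulnS.
have [] := IH f' (A * z ^+ 2) (B * z^-1 ^+ 2).
- rewrite f't fs css cts; ring: zV.
- rewrite f't ft css cst; ring: zV.
move=> gs gr; split=> [|r].
  by rewrite gs mulnS !exprD !mulrA.
rewrite gr f't !big_ord_recl !muln0 !expr0.
have E (y : algC) : \sum_(i < k) y ^+ (2 * bump 0 i) = y ^+ 2 * \sum_(i < k) y ^+ (2 * i).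
  by rewrite mulr_sumr; apply: eq_bigr => i _; rewrite /bump mulnDr exprD.
rewrite !E; ring.
Qed.

(** For a relator with [s != t] the geometric sums of [act_alt] vanish, because [z ^+ 2] differs
    from 1 while its power [m s t] is 1. *)
Lemma act_coxeq u v f : coxeq u v -> act u f =1 act v f.
Proof.
have [mss msym mst1] := cm.
have act_ext w g h : g =1 h -> act w g =1 act w h.
  elim: w g h => //= s w IH g h gh; apply: IH => r.
  by rewrite /reflect_fun !gh.
move=> uv; elim: uv f => {u v} [//|u v _ IH f r|u v w _ IH1 _ IH2 f r|a b s t mst f].
- by rewrite IH.
- by rewrite IH1 IH2.
rewrite !act_cat; apply: act_ext; move: {a b f}(act a f) => f.
have [<-|st] := eqVneq s t.
  by rewrite mss /= /reflect_fun => r; rewrite /cartan eqxx; ring.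
set z := q (m s t); have [z0 zP] := qP (mst1 _ _ st); rewrite -/z in z0 zP.
have z2 : z ^+ 2 != 1.
  by rewrite -[2%N]/(2 * 1)%N zP dvdn1 mst1.
have sum0 (y : algC) : y ^+ 2 != 1 -> y ^+ (2 * m s t) = 1 ->
    \sum_(i < m s t) y ^+ (2 * i) = 0.
  move=> y2 ym; have := subrX1 (y ^+ 2) (m s t); rewrite -exprM ym subrr.
  move/esym/eqP; rewrite mulf_eq0 subr_eq0 (negPf y2) /= => /eqP s0; rewrite -[RHS]s0.
  by apply: eq_bigr => i _; rewrite -exprM.
have zm : z ^+ (2 * m s t) = 1 by apply/eqP; rewrite zP.
have zz : z - z^-1 != 0.
  by apply: contra z2; rewrite subr_eq0 => /eqP e; rewrite expr2 {2}e mulfV.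
(* Solves for the eigenvector components of [f]; the two eigenvectors are independent since [z]
   differs from its inverse. *)
pose B := - (f t + f s * z^-1) / (z - z^-1).
have eB : B * (z - z^-1) = - (f t + f s * z^-1) by rewrite /B mulfVK.
have [||_ gr r] := @act_alt (m s t) s t f (f s - B) B st; rewrite -/z.
- by ring.
- have -> : f t = - (B * (z - z^-1)) - f s * z^-1 by rewrite eB; ring.
  by ring.
rewrite gr -/z !sum0 //; first by ring.
  by rewrite exprVn invr_eq1.
by rewrite exprVn zm invr1.
Qed.

Lemma coxeq_alt_dvd s t i : s != t -> coxeq (alt s t (2 * i)) [::] -> (m s t %| i)%N.
Proof.
have [_ msym mst1] := cm => st /act_coxeq.
set z := q (m s t); have [z0 zP] := qP (mst1 _ _ st); rewrite -/z in z0 zP.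
(* An eigenvector, with components [A = 1] and [B = 0]: the value at [s] gets multiplied by
   [z ^+ (2 * i)]. *)
pose f r : algC := if r == s then 1 else - z^-1.
move=> /(_ f s); have [||-> _] := @act_alt i s t f 1 0 st.
- by rewrite /f eqxx addr0.
- by rewrite /f eq_sym (negPf st) mul1r mul0r addr0.
by rewrite mul1r mul0r addr0 /= /f eqxx -zP => /eqP.
Qed.
End Reflection.

(** * Commutation classes and the bad-factor criterion for full commutativity *)

Section FullyCommutative.
Variables (S : finType) (m : S -> S -> nat).
Hypothesis cm : coxeter_matrix m.

Local Notation coxeq := (coxeq m).
Local Notation reduced := (reduced m).
Local Notation commeq := (commeq m).
Implicit Types (s t r : S) (a b u v w x y : seq S).

Lemma alt_order s t i : s != t -> coxeq (alt s t (2 * i)) [::] -> m s t %| i.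
Proof.
have /choice [q qP] : forall n, exists z : algC, n != 1 ->
    (z != 0 /\ forall i, (z ^+ (2 * i) == 1) = (n %| i)%N)%R.
  (* The value 0 at [n = 1] is a default; off-diagonal entries of [m] are never 1. *)
  move=> n; have [_|/root_of_order [z zP]] := eqVneq n 1; first by exists 0%R.
  by exists z.
exact: (coxeq_alt_dvd cm qP).
Qed.

Lemma commeq_ctx a b u v : commeq u v -> commeq (a ++ u ++ b) (a ++ v ++ b).
Proof.
elim=> {u v} [u|u v _ IH|u v w _ IH1 _ IH2|c d s t mst].
- exact: commeq_refl.
- exact: commeq_sym.
- exact: commeq_trans IH1 IH2.
- by have := commeq_step (a ++ c) (d ++ b) mst; rewrite -!catA.
Qed.

Lemma commeq_catl a u v : commeq u v -> commeq (a ++ u) (a ++ v).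
Proof. by move/(commeq_ctx a [::]); rewrite !cats0. Qed.

Lemma commeq_catr b u v : commeq u v -> commeq (u ++ b) (v ++ b).
Proof. exact: (commeq_ctx [::] b). Qed.

Lemma commeq_cons s u v : commeq u v -> commeq (s :: u) (s :: v).
Proof. exact: (commeq_catl [:: s]). Qed.

Lemma commeq_perm u v : commeq u v -> perm_eq u v.
Proof.
elim=> {u v} [u|u v _ IH|u v w _ IH1 _ IH2|c d s t mst].
- exact: perm_refl.
- by rewrite perm_sym.
- exact: perm_trans IH1 IH2.
- by rewrite perm_cat2l perm_cat2r (perm_catC [:: s] [:: t]).
Qed.

Lemma commeq_coxeq u v : commeq u v -> coxeq u v.
Proof.
elim=> {u v} [u|u v _ IH|u v w _ IH1 _ IH2|c d s t mst].
- exact: coxeq_refl.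
- exact: coxeq_sym.
- exact: coxeq_trans IH1 IH2.
- by apply: coxeq_ctx; have := @coxeq_braid _ _ cm s t; rewrite mst; apply.
Qed.

Lemma reduced_commeq u v : reduced u -> commeq u v -> reduced v.
Proof.
move=> r uv; apply: (reduced_coxeq r (commeq_coxeq uv)).
exact: perm_size (commeq_perm uv).
Qed.

(** The projection to two letters that do not commute is an invariant of the trace; it will tell the
    two sides of a braid relation apart. *)
Lemma commeq_filter2 s t u v : m s t != 2 ->
  commeq u v -> filter (pred2 s t) u = filter (pred2 s t) v.
Proof.
have [mss msym _] := cm.
move=> mst; elim=> {u v} [//|u v _ -> //|u v w _ -> _ -> //|c d x y mxy].
rewrite !filter_cat [filter _ [:: x; y]]/= [filter _ [:: y; x]]/=.
have [/pred2P xst|_] := boolP ((x == s) || (x == t)); last by [].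
have [/pred2P yst|//] := boolP ((y == s) || (y == t)).
case: xst yst mxy => -> [] ->; rewrite ?mss // => /eqP.
  by rewrite (negPf mst).
by rewrite msym (negPf mst).
Qed.

(** Two left descents generate alternating prefixes of every length that the order of [st] allows.
    The induction exchanges the roles of [s] and [t] and then brings one more letter to the front by
    exchange. *)
Lemma common_descents k s t u u' v' : s != t ->
  reduced (s :: u') -> reduced (t :: v') -> coxeq u (s :: u') -> coxeq u (t :: v') ->
  reduced u -> (m s t == 0) || (k <= m s t) ->
  exists2 x, reduced (alt s t k ++ x) & coxeq u (alt s t k ++ x).
Proof.
have [_ msym _] := cm.
elim: k s t u' v' => [|k IH] s t u' v' st rs rt us ut ru km.
  by exists u => //; apply: coxeq_refl.
have [||x rx ux] // := IH t s v' u' _ rt rs ut us ru.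
- by rewrite eq_sym.
- by rewrite msym; case/orP: km => [->//|/ltnW ->]; rewrite orbT.
have [a [c [b [e h]]]] := exchange cm rs (coxeq_trans (coxeq_sym ux) us).
have [lt|le] := ltnP (size a) k.
  have [ea ec] := alt_prefix e lt.
  (* A letter deleted inside the prefix would give [st] an order dividing [(size a).+1], which is at
     most [k] and so too small. *)
  have /(alt_order st) : coxeq (alt s t (2 * (size a).+1)) [::].
    rewrite alt_cat_rev -ec /= -ea; set w := rcons a c.
    apply: coxeq_trans (coxeq_catr (rev w) (coxeq_sym h)) _.
    by have := coxeq_mulKV cm [::] [::] w; rewrite cats0.
  case/orP: km => [/eqP ->|km]; first by rewrite dvd0n.
  by move/(dvdn_leq (ltn0Sn _)); lia.
have [a' ea] : exists a', a = alt t s k ++ a'.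
  exists (drop k a); rewrite -[LHS](cat_take_drop k); congr (_ ++ _).
  by have := congr1 (take k) e; rewrite take_size_cat ?size_alt // takel_cat.
have ux' : coxeq u (alt s t k.+1 ++ a' ++ b).
  apply: coxeq_trans ux _; rewrite e catA -[alt s t k.+1 ++ a']/(s :: _ ++ _) -ea.
  by rewrite -cat_rcons; apply: (coxeq_catr b h).
exists (a' ++ b) => //; apply: (reduced_coxeq rx).
  exact: coxeq_trans (coxeq_sym ux) ux'.
by rewrite e ea !size_cat !size_alt /=; lia.
Qed.

(* The words [alt s t (maxn 2 (m s t))] are the squares s s (as m s s = 1) and
   the braid words of length at least 3. *)
Definition has_bad_factor u : Prop :=
  exists s t, m s t != 0 /\ m s t != 2 /\
    exists a b, commeq u (a ++ alt s t (maxn 2 (m s t)) ++ b).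

Lemma has_bad_factor_commeq u v : commeq u v -> has_bad_factor v -> has_bad_factor u.
Proof.
move=> uv [s [t [m0 [m2 [a [b e]]]]]]; exists s, t; do 2!split=> //.
by exists a, b; apply: commeq_trans e.
Qed.

Lemma has_bad_factor_suffix a u : has_bad_factor u -> has_bad_factor (a ++ u).
Proof.
move=> [s [t [m0 [m2 [c [b e]]]]]]; exists s, t; do 2!split=> //.
by exists (a ++ c), b; rewrite -catA; apply: commeq_catl.
Qed.

(** Induction on length. Equal first letters cancel. Distinct ones are common descents, so the braid
    word of [s] and [t] can be brought to the front; the absence of bad factors forces [m s t = 2],
    and one commutation makes the first letters equal. *)
Lemma no_bad_factor_commeq u v : ~ has_bad_factor u ->
  reduced u -> reduced v -> coxeq u v -> commeq u v.
Proof.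
have [mss msym mst1] := cm.
move: {2}(size u) (leqnn (size u)) => n.
elim: n u v => [|n IH] [|s u] v //= un nb ru rv uv.
- case: v rv uv => [|t v] rv uv; first exact: commeq_refl.
  by have := rv _ (coxeq_sym uv).
- case: v rv uv => [|t v] rv uv; first exact: commeq_refl.
  by have := rv _ (coxeq_sym uv).
case: v rv uv => [|t v] rv uv; first by have := ru _ uv.
have sz : size u = size v.
  by move: (ru _ uv) (rv _ (coxeq_sym uv)) => /=; lia.
have nbs a w : commeq (s :: u) (a ++ w) -> ~ has_bad_factor w.
  by move=> e h; apply: nb; apply: has_bad_factor_commeq e (has_bad_factor_suffix a h).
have nbu : ~ has_bad_factor u by apply: (nbs [:: s]); apply: commeq_refl.
have ru' : reduced u by apply: (@reduced_suffix _ _ [:: s]).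
have rv' : reduced v by apply: (@reduced_suffix _ _ [:: t]).
have [est|st] := eqVneq s t.
  subst t; apply: commeq_cons; apply: IH => //; exact: coxeq_consK uv.
have CD k := @common_descents k s t _ u v st ru rv (coxeq_refl _ _) uv ru.
have m0 : m s t != 0.
  (* For infinite [m s t], an alternating prefix longer than [s :: u] is impossible. *)
  apply/eqP => m0; have [|x rx ux] := CD (size u).+2; first by rewrite m0.
  by have := rx _ (coxeq_sym ux); rewrite size_cat size_alt /=; lia.
have [|x rx ux] := CD (m s t); first by rewrite leqnn orbT.
have [k mk] : exists k, m s t = k.+2.
  by exists (m s t).-2; have := mst1 _ _ st; lia.
rewrite mk /= in rx ux.
(* Both words start with [s], so the induction hypothesis on the tails makes the braid word appear
   by commutations alone. *)
have eu : commeq (s :: u) (alt s t (m s t) ++ x).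
  rewrite mk; apply: commeq_cons; apply: IH => //; last exact: coxeq_consK ux.
  exact: (@reduced_suffix _ _ [:: s]) rx.
have [m2|m2] := eqVneq (m s t) 2; last first.
  case: nb; exists s, t; do 2!split=> //; exists [::], x.
  by rewrite (maxn_idPr _) // mk.
have e1 : commeq (s :: u) (t :: s :: x).
  apply: commeq_trans (commeq_step [::] x m2).
  by move: eu; rewrite m2.
apply: (commeq_trans e1); apply: commeq_cons.
have sx : size u = size (s :: x) by have /perm_size[] := commeq_perm e1.
apply: IH => //.
- by rewrite -sx.
- exact: (nbs [:: t]).
- exact: (@reduced_suffix _ _ [:: t]) (reduced_commeq ru e1).
- apply: (@coxeq_consK _ _ cm t).
  exact: coxeq_trans (coxeq_sym (commeq_coxeq e1)) uv.
Qed.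

(** If prepending [s] to a reduced [u] loses reducedness, then [u] has a reduced expression starting
    with [s]; it is reached by commutations, which exposes the bad factor [s s]. *)
Lemma no_bad_factor_reduced u : ~ has_bad_factor u -> reduced u.
Proof.
have [mss _ _] := cm.
elim: u => [|s u IH] nb; first by [].
have nbu : ~ has_bad_factor u by move=> h; apply: nb; apply: (@has_bad_factor_suffix [:: s]).
have ru := IH nbu; apply: contrapT => /(reduced_or_descent cm ru) [v rv uv].
apply: nb; exists s, s; rewrite mss; do 2!split=> //.
exists [::], v; apply: (@commeq_cons s u (s :: v)).
exact: no_bad_factor_commeq.
Qed.

Lemma reduced_fcP u : reduced u /\ fc_elt m u <-> ~ has_bad_factor u.
Proof.
have [mss msym mst1] := cm.
split=> [[ru fcu] [s [t [m0 [m2 [a [b e]]]]]]|nb]; last first.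
  have ru := no_bad_factor_reduced nb; split=> // v1 v2 r1 r2 e1 e2.
  apply: commeq_trans (no_bad_factor_commeq nb ru r2 e2).
  exact: commeq_sym (no_bad_factor_commeq nb ru r1 e1).
have re := reduced_commeq ru e.
have [est|st] := eqVneq s t.
  subst t; rewrite mss /= in re; have := re _ (coxeq_ss cm a s b).
  by rewrite !size_cat /=; lia.
have mx : maxn 2 (m s t) = m s t by have := mst1 _ _ st; lia.
rewrite mx in e re; have mgt : 0 < m s t by rewrite lt0n.
have br := coxeq_ctx a b (coxeq_braid cm mgt).
have rb : reduced (a ++ alt t s (m s t) ++ b).
  by apply: (reduced_coxeq re br); rewrite !size_cat !size_alt.
have ue := commeq_coxeq e.
(* Both sides of the braid relation are reduced expressions of [u], but their projections to [s] and
   [t] first differ right after [a]. *)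
have := commeq_filter2 m2 (fcu _ _ re rb ue (coxeq_trans ue br)).
rewrite !filter_cat => /eqP; rewrite eqseq_cat // eqxx /= => /eqP.
case: (m s t) mgt => // k _ /=; rewrite !eqxx orbT /=.
by case=> /eqP; rewrite (negPf st).
Qed.

End FullyCommutative.

(** * Closure properties of regular languages and nondeterministic runs *)

Section Regular.
Variable S : finType.
Implicit Types (L X Y : seq S -> Prop) (u v x y : seq S).

Lemma regular_ext L X : (forall u, L u <-> X u) -> regular_language L -> regular_language X.
Proof.
move=> e [Q [q0 [d [F h]]]]; exists Q, q0, d, F => u.
exact: iff_trans (iff_sym (e u)) (h u).
Qed.

Lemma regular_const (P : Prop) : regular_language (fun _ : seq S => P).
Proof.
exists unit, tt, (fun _ _ => tt), (fun _ => `[< P >]) => u.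
by split=> /asboolP.
Qed.

Lemma regular_not L : regular_language L -> regular_language (fun u => ~ L u).
Proof.
move=> [Q [q0 [d [F h]]]]; exists Q, q0, d, (fun q => ~~ F q) => u.
by rewrite h; split=> /negP.
Qed.

Lemma regular_and L X : regular_language L -> regular_language X ->
  regular_language (fun u => L u /\ X u).
Proof.
move=> [Q [q0 [d [F h]]]] [Q' [q0' [d' [F' h']]]].
exists (Q * Q')%type, (q0, q0'), (fun q s => (d q.1 s, d' q.2 s)).
exists (fun q => F q.1 && F' q.2) => u; rewrite h h'.
have -> : foldl (fun q s => (d q.1 s, d' q.2 s)) (q0, q0') u =
          (foldl d q0 u, foldl d' q0' u).
  by elim: u q0 q0' {h h'} => //= s u IH q0 q0'; rewrite IH.
by split=> /andP.
Qed.

(** De Morgan: a finite union is the complement of an intersection of complements, built along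
    [enum I]. *)
Lemma regular_exists (I : finType) (L : I -> seq S -> Prop) :
  (forall i, regular_language (L i)) -> regular_language (fun u => exists i, L i u).
Proof.
move=> reg; suff : regular_language (fun u => forall i, i \in enum I -> ~ L i u).
  move/regular_not; apply: regular_ext => u; split=> [nn|[i Li] /(_ i) []] //.
    by apply: contrapT => ne; apply: nn => i _ Li; apply: ne; exists i.
  by rewrite mem_enum.
elim: (enum I) => [|i r IH].
  by apply: regular_ext (regular_const True) => u; split.
apply: regular_ext (regular_and (regular_not (reg i)) IH) => u; split.
  by move=> [Li Lr] j; rewrite inE => /predU1P[->|/Lr].
move=> h; split=> [|j jr]; first by apply: h; rewrite mem_head.
by apply: h; rewrite inE jr orbT.
Qed.

(** The state type may be infinite: runs over pairs of words are later projected to a finite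
    automaton. *)
Fixpoint run (C : Type) (step : S -> C -> C -> Prop) u (p p' : C) : Prop :=
  if u is c :: u' then exists2 p1, step c p p1 & run step u' p1 p' else p = p'.

Lemma run_cat (C : Type) (step : S -> C -> C -> Prop) u v p p' :
  run step (u ++ v) p p' <-> exists2 p1, run step u p p1 & run step v p1 p'.
Proof.
elim: u p => [|c u IH] p /=.
  by split=> [h|[p1 -> //]]; exists p.
split=> [[p1 s1 /IH [p2 r1 r2]]|[p2 [p1 s1 r1] r2]].
  by exists p2 => //; exists p1.
by exists p1 => //; apply/IH; exists p2.
Qed.

(** The subset construction. *)
Lemma regular_run (C : finType) (step : S -> C -> C -> Prop) (p0 : C) (F : C -> Prop) :
  regular_language (fun u => exists2 p, run step u p0 p & F p).
Proof.
exists {set C}, [set p0].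
pose d (A : {set C}) c := [set p | `[< exists2 p', p' \in A & step c p' p >]].
exists d, (fun A : {set C} => `[< exists2 p, p \in A & F p >]) => u.
have E A p : p \in foldl d A u <-> exists2 p', p' \in A & run step u p' p.
  elim: u A => [|c u IH] A /=.
    by split=> [h|[p' h <- //]]; exists p.
  rewrite IH; split=> [[p1]|[p' h [p1 s r]]].
    by rewrite inE => /asboolP [p' h s] r; exists p' => //; exists p1.
  by exists p1 => //; rewrite inE; apply/asboolP; exists p'.
split=> [[p r Fp]|/asboolP [p /E [p' /set1P -> r] Fp]]; last by exists p.
by apply/asboolP; exists p => //; apply/E; exists p0; rewrite ?set11.
Qed.

End Regular.

(** * Products and conjugates of commutation-closed regular languages *)

Section TraceLanguages.
Variables (S : finType) (m : S -> S -> nat).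
Hypothesis cm : coxeter_matrix m.

Local Notation commeq := (commeq m).
Implicit Types (s t c : S) (a b u v x y : seq S) (X Y : seq S -> Prop).
Implicit Types p : seq S * seq S.

Definition comm_closed X := forall u v, commeq u v -> X u -> X v.

Definition trace_prod X Y u := exists x y, [/\ X x, Y y & commeq u (x ++ y)].

Lemma comm_closed_trace_prod X Y : comm_closed (trace_prod X Y).
Proof.
move=> u v uv [x [y [Xx Yy e]]]; exists x, y; split=> //.
exact: commeq_trans (commeq_sym uv) e.
Qed.

Lemma commeq_commute c y : all (fun d => m c d == 2) y ->
  commeq (y ++ [:: c]) (c :: y).
Proof.
have [_ msym _] := cm.
elim: y => [|d y IH] /=; first by move=> _; apply: commeq_refl.
case/andP=> /eqP cd /IH e; apply: commeq_trans (commeq_cons d e) _.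
by apply: (@commeq_step _ _ [::] y d c); rewrite msym.
Qed.

(* A run from the pair of empty words distributes the letters of u among two
   words x and y so that u = x y in the trace monoid: a letter may join x only
   if it commutes with all letters already put in y. *)
Definition deal_step c p p' :=
  p' = (p.1, rcons p.2 c) \/
  p' = (rcons p.1 c, p.2) /\ all (fun d => m c d == 2) p.2.

Local Notation deal := (run deal_step).

(** Invariant: the two dealt words followed by the unread letters keep the same trace. *)
Lemma deal_sound u p p' : deal u p p' -> commeq (p.1 ++ p.2 ++ u) (p'.1 ++ p'.2).
Proof.
elim: u p => [|c u IH] p /=; first by move=> <-; rewrite cats0; apply: commeq_refl.
case=> p1 st /IH e; apply: commeq_trans e; case: st => [->|[-> al]] /=.
  by rewrite cat_rcons; apply: commeq_refl.
rewrite cat_rcons; apply: commeq_catl.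
by have := commeq_catr u (commeq_commute al); rewrite -catA.
Qed.

Lemma deal_cat x y : deal (x ++ y) ([::], [::]) (x, y).
Proof.
have dx z : deal x (z, [::]) (z ++ x, [::]).
  elim: x z => [|c x IH] z /=; first by rewrite cats0.
  by exists (rcons z c, [::]); [right|rewrite -cat_rcons; apply: IH].
have dy z : deal y (x, z) (x, z ++ y).
  elim: y z => [|c y IH] z /=; first by rewrite cats0.
  by exists (x, rcons z c); [left|rewrite -cat_rcons; apply: IH].
by apply/run_cat; exists (x, [::]); [apply: (dx [::])|apply: (dy [::])].
Qed.

Definition commeq2 (p q : seq S * seq S) := commeq p.1 q.1 /\ commeq p.2 q.2.

Lemma commeq2_trans p q r : commeq2 p q -> commeq2 q r -> commeq2 p r.
Proof.
by move=> [h1 h2] [h3 h4]; split; [apply: commeq_trans h1 h3|apply: commeq_trans h2 h4].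
Qed.

Lemma commeq2_refl p : commeq2 p p.
Proof. by split; apply: commeq_refl. Qed.

(** Whether a letter may join the first word depends only on the letters of the second, which
    commutations preserve. *)
Lemma deal_commeq2 u p q p' : commeq2 p q -> deal u p p' ->
  exists2 q', deal u q q' & commeq2 p' q'.
Proof.
elim: u p q => [|c u IH] p q e /=; first by move=> <-; exists q.
case=> p1 st r; have [e1 e2] := e.
have [q1 sq eq1] : exists2 q1, deal_step c q q1 & commeq2 p1 q1.
  case: st => [->|[-> al]].
    exists (q.1, rcons q.2 c); first by left.
    by split=> //; rewrite -!cats1; apply: commeq_catr.
  exists (rcons q.1 c, q.2); last first.
    by split=> //; rewrite -!cats1; apply: commeq_catr.
  by right; rewrite -(perm_all _ (commeq_perm e2)).
by have [q' rq eq'] := IH _ _ eq1 r; exists q' => //; exists q1.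
Qed.

Lemma deal_swap s t p p' : m s t = 2 -> deal [:: s; t] p p' ->
  exists2 q', deal [:: t; s] p q' & commeq2 p' q'.
Proof.
have [_ msym _] := cm.
case: p => x y mst [p1 st [p2 st' <-]] {p'}.
have mts : m t s = 2 by rewrite msym.
case: st st' => [->|[-> al]] /= [->|[-> al']] /=.
- exists (x, rcons (rcons y t) s).
    by exists (x, rcons y t); [left|exists (x, rcons (rcons y t) s); [left|]].
  split; first exact: commeq_refl.
  by rewrite /= -!cats1 -!catA; apply: (@commeq_step _ _ y [::]).
- move: al'; rewrite /= all_rcons => /andP [_ al'].
  exists (rcons x t, rcons y s); last exact: commeq2_refl.
  by exists (rcons x t, y); [right|exists (rcons x t, rcons y s); [left|]].
- exists (rcons x s, rcons y t); last exact: commeq2_refl.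
  exists (x, rcons y t); [left|exists (rcons x s, rcons y t)] => //.
  by right; split=> //=; rewrite all_rcons mst eqxx.
- exists (rcons (rcons x t) s, y).
    by exists (rcons x t, y); [right|exists (rcons (rcons x t) s, y); [right|]].
  split; last exact: commeq_refl.
  by rewrite /= -!cats1 -!catA; apply: (@commeq_step _ _ x [::]).
Qed.

Lemma deal_commeq u v p p' : commeq u v -> deal u p p' ->
  exists2 q', deal v p q' & commeq2 p' q'.
Proof.
have [_ msym _] := cm; move=> uv.
(* Both directions at once, so that the induction passes through the symmetry rule. *)
suff [h _] : (forall p p', deal u p p' -> exists2 q', deal v p q' & commeq2 p' q') /\
             (forall p p', deal v p p' -> exists2 q', deal u p q' & commeq2 p' q').
  exact: h.
elim: uv {p p'} => {u v} [u|u v _ [] //|u v w _ [IH1 IH2] _ [IH3 IH4]|a b s t mst].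
- by split=> p p' r; exists p' => //; apply: commeq2_refl.
- split=> p p'.
    case/IH1=> q rq e1; have [q' rq' e2] := IH3 _ _ rq.
    by exists q' => //; apply: commeq2_trans e2.
  case/IH4=> q rq e1; have [q' rq' e2] := IH2 _ _ rq.
  by exists q' => //; apply: commeq2_trans e2.
have half s' t' p p' : m s' t' = 2 -> deal (a ++ [:: s'; t'] ++ b) p p' ->
    exists2 q', deal (a ++ [:: t'; s'] ++ b) p q' & commeq2 p' q'.
  move=> mst' /run_cat [p1 r1 /run_cat [p2 r2 r3]].
  have [q2 rq2 e2] := deal_swap mst' r2.
  have [q3 rq3 e3] := deal_commeq2 e2 r3.
  exists q3 => //; apply/run_cat; exists p1 => //.
  by apply/run_cat; exists q2.
by split=> p p'; apply: half; rewrite // msym.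
Qed.

(** Dealing needs only finite memory: the automaton states reached on the two words, and the set of
    letters in the second. *)
Lemma regular_trace_prod X Y :
  comm_closed X -> comm_closed Y -> regular_language X -> regular_language Y ->
  regular_language (trace_prod X Y).
Proof.
move=> cX cY [Q1 [q1 [d1 [F1 h1]]]] [Q2 [q2 [d2 [F2 h2]]]].
pose C : finType := (Q1 * Q2 * {set S})%type.
pose step c (p p' : C) :=
  p' = (p.1.1, d2 p.1.2 c, c |: p.2) \/
  p' = (d1 p.1.1 c, p.1.2, p.2) /\ (forall d, d \in p.2 -> m c d = 2).
pose proj p : C := (foldl d1 q1 p.1, foldl d2 q2 p.2, [set d in p.2]).
have stepP c p r : step c (proj p) r <-> exists2 p', deal_step c p p' & r = proj p'.
  have projl : (d1 (foldl d1 q1 p.1) c, foldl d2 q2 p.2, [set d in p.2]) =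
               proj (rcons p.1 c, p.2) by rewrite /proj /= foldl_rcons.
  have projr : (foldl d1 q1 p.1, d2 (foldl d2 q2 p.2) c, c |: [set d in p.2]) =
               proj (p.1, rcons p.2 c).
    rewrite /proj /= foldl_rcons; congr (_, _).
    by apply/setP => d; rewrite !inE mem_rcons inE.
  split=> [[->|[-> al]]|[p' [->|[-> al]] ->]].
  - by exists (p.1, rcons p.2 c); [left|].
  - exists (rcons p.1 c, p.2); [right; split=> //|exact: projl].
    by apply/allP => d dp; apply/eqP/al; rewrite inE.
  - by left.
  - right; split; first by rewrite -projl.
    by move=> d; rewrite inE => /(allP al) /eqP.
have runP u p r : run step u (proj p) r <-> exists2 p', deal u p p' & r = proj p'.
  elim: u p r => [|c u IH] p r /=.
    by split=> [<-|[p' -> ->]] //; exists p.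
  split=> [[r1 /stepP [p1 s1 ->] /IH [p' d ->]]|[p' [p1 s1 d] ->]].
    by exists p' => //; exists p1.
  by exists (proj p1); [apply/stepP; exists p1|apply/IH; exists p'].
have := regular_run step (proj ([::], [::])) (fun r => F1 r.1.1 /\ F2 r.1.2).
apply: regular_ext => u; split.
  case=> r /runP [[x y] du ->] /= [/h1 Xx /h2 Yy]; exists x, y; split=> //.
  exact: deal_sound du.
case=> x [y [Xx Yy /commeq_sym e]].
(* The run that splits [x ++ y] is carried over to [u]; it ends in words equivalent to [x] and [y],
   hence the closure hypotheses. *)
have [[x' y'] du [/= ex ey]] := deal_commeq e (deal_cat x y).
exists (proj (x', y')); first by apply/runP; exists (x', y').
by split; [apply/h1/(cX _ _ ex)|apply/h2/(cY _ _ ey)].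
Qed.

Lemma comm_closed_letter c : comm_closed (eq [:: c]).
Proof.
by move=> u v /commeq_perm uv e; apply/esym/perm_small_eq; rewrite // e perm_sym.
Qed.

Lemma regular_letter c : regular_language (eq [:: c]).
Proof.
(* [None] means that nothing has been read; [Some true] means that exactly [c] has. *)
pose d (i : option bool) s := Some ((i == None) && (s == c)).
exists (option bool), None, d, (pred1 (Some true)) => u.
have dead w i : foldl d (Some i) w = Some (i && (w == [::])).
  by elim: w i => [|s w IH] i; rewrite /= ?IH ?andbF ?andbT.
case: u => [|s u] /=; first by split.
rewrite /d eqxx dead; split=> [[-> <-]|/eqP[/andP[/eqP -> /eqP ->]]] //.
by rewrite !eqxx.
Qed.

(** The trace product of all words, the letters of [b] one by one, and all words again. *)
Lemma regular_factor b : regular_language (fun u => exists x y, commeq u (x ++ b ++ y)).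
Proof.
pose P b u := exists y, commeq u (b ++ y).
have cT : comm_closed (fun _ => True) by [].
have [cP rP] : comm_closed (P b) /\ regular_language (P b).
  elim: b => [|c b [cP rP]].
    have PT u : True <-> P [::] u by split=> // _; exists u; apply: commeq_refl.
    split=> [u v _ _|]; first exact/PT.
    exact: regular_ext PT (regular_const _ True).
  have E u : trace_prod (eq [:: c]) (P b) u <-> P (c :: b) u.
    split=> [[x [z [<- [y e] e']]]|[y e]].
      by exists y; apply: commeq_trans e' _; apply: commeq_cons.
    exists [:: c], (b ++ y); split=> //; exists y; exact: commeq_refl.
  split=> [u v uv /E h|]; first by apply/E; apply: comm_closed_trace_prod h.
  apply: regular_ext E (regular_trace_prod _ cP (regular_letter c) rP).
  exact: comm_closed_letter.
apply: regular_ext (regular_trace_prod cT cP (regular_const _ True) rP) => u.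
split=> [[x [z [_ [y e] e']]]|[x [y e]]].
  by exists x, y; apply: commeq_trans e' _; apply: commeq_catl.
by exists x, (b ++ y); split=> //; exists y; apply: commeq_refl.
Qed.

(* If v = x y and q is the state reached on y, then y x is in K iff x leads from
   q to a final state, so u is in the language iff u lies in one of finitely many
   trace products. *)
Lemma regular_conjugates K : comm_closed K -> regular_language K ->
  regular_language (fun u => exists v k, commeq u v /\ K (rot k v)).
Proof.
move=> cK [Q [q0 [d [F h]]]].
pose X q x := F (foldl d q x) : Prop.
(* Nerode equivalence instead of [foldl d q0 y = q]: equivalent words may reach different states,
   and [Y q] must be closed under commutation. *)
pose Y q y := (forall x, F (foldl d q0 (y ++ x)) = F (foldl d q x)) : Prop.
have KF u v : commeq u v -> F (foldl d q0 u) = F (foldl d q0 v).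
  move=> uv; apply/idP/idP => /h; [move/(cK _ _ uv)|move/(cK _ _ (commeq_sym uv))];
    by move/h.
have rX q : regular_language (X q) by exists Q, q, d, F.
have rY q : regular_language (Y q).
  exists Q, q0, d, (fun q' => `[< forall x, F (foldl d q' x) = F (foldl d q x) >]) => y.
  by split=> [Yy|/asboolP Yy]; [apply/asboolP|]; move=> x; move: (Yy x); rewrite foldl_cat.
have cY q : comm_closed (Y q).
  by move=> u v uv Yu x; rewrite -Yu; apply/esym/KF/commeq_catr.
(* Restricting to reachable states makes [X q] a left quotient of [K] by a word, hence
   commutation-closed. *)
have reg q : regular_language
    (fun u => (exists y, foldl d q0 y = q) /\ trace_prod (X q) (Y q) u).
  have [[y0 e0]|nr] := pselect (exists y, foldl d q0 y = q); last first.
    by apply: regular_ext (regular_const _ False) => u; split=> // -[].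
  have cX : comm_closed (X q).
    move=> u v uv; rewrite /X -e0 -!foldl_cat.
    by rewrite (KF _ _ (commeq_catl y0 uv)).
  apply: regular_ext (regular_trace_prod cX (cY q) (rX q) (rY q)) => u.
  by split=> [t|[]] //; split=> //; exists y0.
apply: regular_ext (regular_exists reg) => u; split.
  case=> q [_ [x [y [Xx Yy e]]]]; exists (x ++ y), (size x); split=> //.
  by rewrite rot_size_cat; apply/h; rewrite Yy.
case=> v [k [e /h]]; rewrite /rot foldl_cat => Fv.
exists (foldl d q0 (drop k v)); split; first by exists (drop k v).
exists (take k v), (drop k v); rewrite cat_take_drop; split=> // x.
by rewrite foldl_cat.
Qed.

End TraceLanguages.

(** * Cyclically fully commutative elements *)

Lemma cfc_languageP (S : finType) (m : S -> S -> nat) (u : seq S) :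
  coxeter_matrix m ->
  cfc_language m u <-> ~ exists v k, commeq m u v /\ has_bad_factor m (rot k v).
Proof.
move=> cm; split=> [[ru cu] [v [k [e]]]|nb].
  apply/(reduced_fcP cm); apply: cu (commeq_coxeq cm e) k.
  exact: reduced_commeq ru e.
have nbk v k : commeq m u v -> reduced m (rot k v) /\ fc_elt m (rot k v).
  by move=> e; apply/(reduced_fcP cm) => h; apply: nb; exists v, k.
(* Rotation by 0 shows that [u] itself is reduced and FC, so all reduced expressions of its element
   lie in its commutation class. *)
have [ru fcu] : reduced m u /\ fc_elt m u.
  by have := nbk u 0 (commeq_refl _ _); rewrite rot0.
split=> // v rv uv; have := fcu u v ru rv (coxeq_refl _ _) uv => e k.
exact: nbk.
Qed.

Theorem theorem3 (S : finType) (m : S -> S -> nat) :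
  coxeter_matrix m -> regular_language (cfc_language m).
Proof.
move=> cm; apply: regular_ext (fun u => iff_sym (cfc_languageP u cm)) _.
apply/regular_not/(regular_conjugates cm).
  by move=> u v uv; apply: has_bad_factor_commeq; apply: commeq_sym.
apply: (@regular_exists S S) => s; apply: (@regular_exists S S) => t.
do 2!apply: regular_and (regular_const _ _) _.
exact: regular_factor.
Qed.
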